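(* Let $U$ be an effectively optimal machine, and let $A=\{x: U(x)=0\}$ and $B=\{x:U(x)=1\}$ (where $0,1$ denote the one-bit strings). Then $A$ and $B$ are disjoint and computably inseparable. Moreover, for every partial computable function $h$ from binary strings to $\{0,1\}$, letting $$E_n=\frac{\#\{x: |x|\le n,\ h(x)\text{ undefined, or } (x\in A\wedge h(x)=1), \text{ or } (x\in B\wedge h(x)=0)\}}{2^{n+1}},$$ we have $\liminf_n E_n>0$.
   Context: A machine is a partial computable function from binary strings to binary strings. A total function $h$ on strings is length-bounded if $|h(x)|\le|x|+c$ for some $c$ and all $x$. $U$ is effectively optimal if for every machine $V$ there is a total computable length-bounded $h$ with $V(x)=U(h(x))$ for all $x$ (both sides undefined, or both defined and equal). Disjoint sets $A,B$ are computably inseparable if there is no total computable $0/1$-valued $h$ with $h=0$ on $A$ and $h=1$ on $B$. *)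

(* Defs.v *)
From HB Require Import structures.
From mathcomp Require Import all_boot all_order all_algebra.
From mathcomp Require Import all_classical all_reals all_analysis.
From Stdlib Require Import ClassicalDescription.
Set Implicit Arguments. Unset Strict Implicit. Unset Printing Implicit Defensive.
Import Order.TTheory GRing.Theory Num.Theory.

(* A standard model of computation: partial recursive (mu-recursive)        *)
(* functions on nat.  Arity is untyped: arguments are lists of nat, a       *)
(* missing argument is read as 0 (a computable convention).                 *)
Inductive prf : Type :=
| PZero : prf
| PSucc : prf
| PProj : nat -> prf
| PComp : prf -> list prf -> prf
| PPrec : prf -> prf -> prf
| PMu   : prf -> prf.

Inductive eval : prf -> list nat -> nat -> Prop :=
| evZero v : eval PZero v 0
| evSucc v : eval PSucc v (head 0 v).+1
| evProj i v : eval (PProj i) v (nth 0 v i)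
| evComp f gs v ws y : evals gs v ws -> eval f ws y -> eval (PComp f gs) v y
| evPrec0 f g v y : eval f v y -> eval (PPrec f g) (0 :: v) y
| evPrecS f g n v z y : eval (PPrec f g) (n :: v) z -> eval g (n :: z :: v) y ->
    eval (PPrec f g) (n.+1 :: v) y
| evMu f v n : eval f (n :: v) 0 ->
    (forall m, m < n -> exists k, eval f (m :: v) k.+1) -> eval (PMu f) v n
with evals : list prf -> list nat -> list nat -> Prop :=
| evsNil v : evals [::] v [::]
| evsCons g gs v w ws : eval g v w -> evals gs v ws -> evals (g :: gs) v (w :: ws).

(* Binary strings and the standard bijection strings <-> nat:
   s |-> (the number with binary expansion 1s) - 1. *)
Definition bstr := seq bool.
Definition code_of (s : bstr) : nat := (foldl (fun a (b : bool) => a.*2 + b) 1 s).-1.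

Definition runs (M : prf) (x y : bstr) : Prop := eval M [:: code_of x] (code_of y).
Definition defined (M : prf) (x : bstr) : Prop := exists y, runs M x y.
Definition total (M : prf) : Prop := forall x, defined M x.
Definition length_bounded (h : prf) : Prop :=
  exists c, forall x y, runs h x y -> size y <= size x + c.

Definition effectively_optimal (U : prf) : Prop :=
  forall V : prf, exists h : prf, total h /\ length_bounded h /\
    forall x hx, runs h x hx -> forall y, runs V x y <-> runs U hx y.

Definition bit0 : bstr := [:: false].
Definition bit1 : bstr := [:: true].

Definition bit_valued (h : prf) : Prop :=
  forall x y, runs h x y -> y = bit0 \/ y = bit1.

Definition disjoint_sets (A B : bstr -> Prop) : Prop := forall x, ~ (A x /\ B x).

Definition computably_inseparable (A B : bstr -> Prop) : Prop :=
  ~ exists h : prf, total h /\ bit_valued h /\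
      (forall x, A x -> runs h x bit0) /\ (forall x, B x -> runs h x bit1).

Fixpoint strs_of_len (k : nat) : seq bstr :=
  if k is k'.+1 then [seq b :: s | b <- [:: false; true], s <- strs_of_len k']
  else [:: [::]].
Definition strs_upto (n : nat) : seq bstr := flatten [seq strs_of_len k | k <- seq.iota 0 n.+1].

Definition pdec (P : Prop) : bool := if excluded_middle_informative P then true else false.
Definition pcount (T : Type) (P : T -> Prop) (s : seq T) : nat :=
  size [seq x <- s | pdec (P x)].

Definition err (h : prf) (A B : bstr -> Prop) (x : bstr) : Prop :=
  ~ defined h x \/ (A x /\ runs h x bit1) \/ (B x /\ runs h x bit0).

Local Open Scope ring_scope.
Definition err_density (R : realType) (h : prf) (A B : bstr -> Prop) (n : nat) : R :=
  (pcount (err h A B) (strs_upto n))%:R / (2 ^ n.+1)%:R.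

(* Main.v *)
(** Let [h] be a bit-valued machine and let [V] be a machine that on input [N]
    reads off an index [e] from [N], runs the [e]-th program on [N] and then [U]
    on the result; let [g] be a total computable length-bounded reduction of
    [V] to [U]. Choose [e] so that the [e]-th program knows [g] (no recursion
    theorem is needed, as [g] depends on [V] only): on [N] it outputs a
    [U]-description of [1 - h (g N)], unless [g N] is already a value of [g] at
    a smaller input with index [e], in which case it outputs a [U]-description
    of a third string. Such a collision is contradictory, since [U] would take
    that third string and [1 - h (g N)] at the same point. So [g] is injective
    on the inputs of index [e], which have positive density, and at each of its
    values [U] equals the negation of [h]: these are errors of [h]. A total
    separator has no errors at all, hence inseparability. *)
Require Import Defs.
From HB Require Import structures.
From mathcomp Require Import all_boot all_order all_algebra.
From mathcomp Require Import all_classical all_reals all_analysis.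
Import Order.TTheory GRing.Theory Num.Theory.
Local Notation eval := Defs.eval.

(** * Induction on evaluations and determinism *)

(* [eval] is nested under [exists] in [evMu], so the automatic schemes give no
   induction hypothesis there. *)
Section EvalInduction.
Variables (P : prf -> seq nat -> nat -> Prop).
Variables (Q : seq prf -> seq nat -> seq nat -> Prop).
Hypothesis PZ : forall v, P PZero v 0.
Hypothesis PS : forall v, P PSucc v (head 0 v).+1.
Hypothesis PP : forall i v, P (PProj i) v (nth 0 v i).
Hypothesis PC : forall f gs v ws y,
  Q gs v ws -> P f ws y -> P (PComp f gs) v y.
Hypothesis P0 : forall f g v y, P f v y -> P (PPrec f g) (0 :: v) y.
Hypothesis PR : forall f g n v z y, P (PPrec f g) (n :: v) z ->
  P g (n :: z :: v) y -> P (PPrec f g) (n.+1 :: v) y.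
Hypothesis PM : forall f v n, P f (n :: v) 0 ->
  (forall m, m < n -> exists2 k, eval f (m :: v) k.+1 & P f (m :: v) k.+1) ->
  P (PMu f) v n.
Hypothesis QN : forall v, Q [::] v [::].
Hypothesis QC : forall g gs v w ws,
  P g v w -> Q gs v ws -> Q (g :: gs) v (w :: ws).

Fixpoint eval_nested_ind p v y (H : eval p v y) {struct H} : P p v y :=
  match H with
  | evZero v => PZ v
  | evSucc v => PS v
  | evProj i v => PP i v
  | evComp _ _ _ _ _ Hg Hf =>
      PC _ _ _ _ _ (evals_nested_ind _ _ _ Hg) (eval_nested_ind _ _ _ Hf)
  | evPrec0 _ g _ _ Hf => P0 _ g _ _ (eval_nested_ind _ _ _ Hf)
  | evPrecS _ _ _ _ _ _ Hz Hg =>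
      PR _ _ _ _ _ _ (eval_nested_ind _ _ _ Hz) (eval_nested_ind _ _ _ Hg)
  | evMu _ _ _ H0 Hlt => PM _ _ _ (eval_nested_ind _ _ _ H0)
      (fun m lt_mn => match Hlt m lt_mn with
        | ex_intro k Hk => ex_intro2 _ _ k Hk (eval_nested_ind _ _ _ Hk) end)
  end
with evals_nested_ind gs v ws (H : evals gs v ws) {struct H} : Q gs v ws :=
  match H with
  | evsNil v => QN v
  | evsCons _ _ _ _ _ Hg Hgs =>
      QC _ _ _ _ _ (eval_nested_ind _ _ _ Hg) (evals_nested_ind _ _ _ Hgs)
  end.
End EvalInduction.

Lemma eval_functional p v y y' : eval p v y -> eval p v y' -> y = y'.
Proof.
move=> H; move: p v y H y'.
apply: (eval_nested_ind _ (fun gs v ws => forall ws', evals gs v ws' -> ws = ws')).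
- by move=> v y' H; inversion H.
- by move=> v y' H; inversion H.
- by move=> i v y' H; inversion H.
- move=> f gs v ws y IHg IHf y' H.
  inversion H as [| | | ? ? ? ws' ? Hg Hf | | |]; subst.
  by apply: IHf; rewrite (IHg _ Hg).
- move=> f g v y IH y' H.
  by inversion H as [| | | | ? ? ? ? Hf | |]; subst; apply: IH.
- move=> f g n v z y IHz IHg y' H.
  inversion H as [| | | | | ? ? ? ? z' ? Hz Hg |]; subst.
  by apply: IHg; rewrite (IHz _ Hz).
- move=> f v n IH0 IHlt n' H.
  inversion H as [| | | | | | ? ? ? H0 Hlt]; subst.
  (* If the two minimisers differed, [f] would take both the value 0 and a nonzero value at the
     smaller one. *)
  case: (ltngtP n n') => // lt.
    by have [k Hk] := Hlt _ lt; have := IH0 _ Hk.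
  by have [k _ IHk] := IHlt _ lt; have := IHk _ H0.
- by move=> v ws' H; inversion H.
- move=> g gs v w ws IHg IHgs ws' H.
  inversion H as [| ? ? ? ? ? Hg Hgs]; subst.
  by rewrite (IHg _ Hg) (IHgs _ Hgs).
Qed.

(** * Recursive functions *)

(** With the length of the argument list fixed, a program can rebuild the whole list by projections
    and hand it to a subprogram. *)
Definition recursive k (f : seq nat -> nat) :=
  exists p, forall v, size v = k -> eval p v (f v).

Lemma eq_recursive k f g :
  (forall v, size v = k -> f v = g v) -> recursive k f -> recursive k g.
Proof. by move=> fg [p Hp]; exists p => v sv; rewrite -fg //; exact: Hp. Qed.

Lemma rec_nth k i : recursive k (fun v => nth 0 v i).
Proof. by exists (PProj i) => v _; constructor. Qed.

Lemma rec_succ k f : recursive k f -> recursive k (fun v => (f v).+1).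
Proof.
case=> p Hp; exists (PComp PSucc [:: p]) => v sv.
apply: (evComp (ws := [:: f v])); last exact: (evSucc [:: f v]).
by constructor; [exact: Hp | constructor].
Qed.

Lemma rec_const k c : recursive k (fun=> c).
Proof. by elim: c => [|c]; [exists PZero => v _; constructor | exact: rec_succ]. Qed.

Lemma rec_comp1 k F f : recursive 1 (fun v => F (nth 0 v 0)) ->
  recursive k f -> recursive k (fun v => F (f v)).
Proof.
move=> [P HP] [p Hp]; exists (PComp P [:: p]) => v sv.
apply: (evComp (ws := [:: f v])); last exact: (HP [:: f v]).
by constructor; [exact: Hp | constructor].
Qed.

Lemma rec_comp2 k F f g :
  recursive 2 (fun v => F (nth 0 v 0) (nth 0 v 1)) ->
  recursive k f -> recursive k g -> recursive k (fun v => F (f v) (g v)).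
Proof.
move=> [P HP] [p Hp] [q Hq]; exists (PComp P [:: p; q]) => v sv.
apply: (evComp (ws := [:: f v; g v])); last exact: (HP [:: f v; g v]).
by constructor; [exact: Hp | constructor; [exact: Hq | constructor]].
Qed.

Lemma evals_proj v m k : size v = m + k ->
  evals [seq PProj i | i <- iota m k] v (drop m v).
Proof.
elim: k m => [|k IH] m sv /=.
  by rewrite drop_oversize ?sv ?addn0 //; constructor.
rewrite (drop_nth 0) ?sv ?addnS ?ltnS ?leq_addr //.
by constructor; [constructor | apply: IH; rewrite sv addnS].
Qed.

Lemma rec_behead k f : recursive k f -> recursive k.+1 (fun v => f (behead v)).
Proof.
move=> [p Hp]; exists (PComp p [seq PProj i | i <- iota 1 k]) => v sv.
apply: (evComp (ws := behead v)); first by rewrite -drop1; apply: evals_proj.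
by apply: Hp; rewrite size_behead sv.
Qed.

Lemma rec_iter k n F x : recursive k n ->
  recursive k.+1 (fun w => F (behead w) (head 0 w)) -> recursive k x ->
  recursive k (fun v => iter (n v) (F v) (x v)).
Proof.
move=> [pn Hn] [pF HF] [px Hx].
(* Primitive recursion calls [g] on [m :: z :: v]; the projections from 1 on discard the counter
   [m]. *)
pose g := PComp pF [seq PProj i | i <- iota 1 k.+1].
exists (PComp (PPrec px g) (pn :: [seq PProj i | i <- iota 0 k])) => v sv.
apply: (evComp (ws := n v :: v)).
  by constructor; [exact: Hn | have := evals_proj v 0 k sv; rewrite drop0].
elim: (n v) => [|m IH] /=; first by constructor; apply: Hx.
apply: evPrecS IH _; set z := iter _ _ _.
apply: (evComp (ws := z :: v)); last by apply: (HF (z :: v)); rewrite /= sv.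
by have := evals_proj (m :: z :: v) 1 k.+1; apply; rewrite /= sv.
Qed.

Lemma rec_if0 k n f g : recursive k n -> recursive k f -> recursive k g ->
  recursive k (fun v => if n v == 0 then f v else g v).
Proof.
move=> Hn Hf Hg.
(* Zero rounds of the constant map leave [f v]; any positive number of rounds gives [g v]. *)
apply: (@eq_recursive _ (fun v => iter (n v) (fun=> g v) (f v))).
  by move=> v _; case: (n v).
by apply: (rec_iter _ _ (fun v _ => g v)) => //; apply: rec_behead.
Qed.

(** Here [m] may be any Rocq function, for instance one defined by [ex_minn]: unbounded search finds
    it because it is the least zero of [P]. *)
Lemma rec_mu k (m : seq nat -> nat) (P : nat -> seq nat -> nat) :
  recursive k.+1 (fun w => P (head 0 w) (behead w)) ->
  (forall v, size v = k -> P (m v) v = 0) ->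
  (forall v i, size v = k -> i < m v -> P i v != 0) -> recursive k m.
Proof.
move=> [p Hp] P0 Plt; exists (PMu p) => v sv; constructor.
  by rewrite -[X in eval _ _ X](P0 v sv); apply: (Hp (m v :: v)); rewrite /= sv.
move=> i lt; exists (P i v).-1; rewrite prednK ?lt0n ?Plt //.
by apply: (Hp (i :: v)); rewrite /= sv.
Qed.

Lemma rec_pred k f : recursive k f -> recursive k (fun v => (f v).-1).
Proof.
apply: (rec_comp1 _ predn).
exists (PComp (PPrec PZero (PProj 0)) [:: PProj 0]) => v _.
apply: (evComp (ws := [:: nth 0 v 0])); first by repeat constructor.
elim: (nth 0 v 0) => [|n IH] /=; first by repeat constructor.
by apply: evPrecS IH _; apply: (evProj 0).
Qed.

Lemma rec_head k : recursive k (head 0).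
Proof. by apply: (eq_recursive k _ _ _ (rec_nth k 0)) => -[]. Qed.

Lemma rec_nth_behead k i : recursive k (fun v => nth 0 (behead v) i).
Proof.
by apply: (eq_recursive k _ _ _ (rec_nth k i.+1)) => v _; rewrite nth_behead.
Qed.

Lemma rec_addn k f g : recursive k f -> recursive k g ->
  recursive k (fun v => f v + g v).
Proof.
apply: (rec_comp2 _ addn).
apply: (@eq_recursive _ (fun v => iter (nth 0 v 0) S (nth 0 v 1))).
  by move=> v _; rewrite iter_succn addnC.
apply: (rec_iter _ _ (fun=> S)); try exact: rec_nth.
by apply: rec_succ; apply: rec_head.
Qed.

Lemma rec_subn k f g : recursive k f -> recursive k g ->
  recursive k (fun v => f v - g v).
Proof.
apply: (rec_comp2 _ subn).
apply: (@eq_recursive _ (fun v => iter (nth 0 v 1) predn (nth 0 v 0))).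
  by move=> v _; rewrite iter_predn.
apply: (rec_iter _ _ (fun=> predn)); try exact: rec_nth.
by apply: rec_pred; apply: rec_head.
Qed.

Lemma rec_double k f : recursive k f -> recursive k (fun v => (f v).*2).
Proof.
move=> Hf; apply: (@eq_recursive _ (fun v => f v + f v)).
  by move=> v _; rewrite addnn.
exact: rec_addn.
Qed.

Lemma rec_odd k f : recursive k f -> recursive k (fun v => odd (f v)).
Proof.
apply: (rec_comp1 _ odd).
apply: (@eq_recursive _ (fun v => iter (nth 0 v 0) (fun b => 1 - b) 0)).
  by move=> v _; elim: (nth _ _ _) => //= n ->; case: (odd n).
apply: (rec_iter _ _ (fun _ b => 1 - b)); try exact: rec_nth; try exact: rec_const.
by apply: rec_subn; [apply: rec_const | apply: rec_head].
Qed.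

Lemma rec_half k f : recursive k f -> recursive k (fun v => (f v)./2).
Proof.
apply: (rec_comp1 _ half).
(* The half of [n] is the least [i] with [n <= 2i + 1]. *)
apply: (rec_mu _ _ (fun i v => nth 0 v 0 - i.*2.+1)).
- apply: rec_subn; first exact: rec_nth_behead.
  by apply/rec_succ/rec_double/rec_head.
- move=> v _; apply/eqP; rewrite subn_eq0.
  by rewrite -[leqLHS]odd_double_half; case: odd.
- move=> v i _ lt; rewrite subn_eq0 -ltnNge.
  rewrite -[ltnRHS]odd_double_half; apply: (@leq_trans (nth 0 v 0)./2.*2).
    by rewrite -doubleS leq_double.
  exact: leq_addl.
Qed.

(** This is the case analysis of [step] on the tag. [List.In] stands for membership because
    functions have no decidable equality. *)
Lemma rec_switch k n (fs : seq (seq nat -> nat)) : recursive k n ->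
  (forall f, List.In f fs -> recursive k f) ->
  recursive k (fun v => nth 0 [seq f v | f <- fs] (n v)).
Proof.
elim: fs n => [|f fs IH] n Hn Hfs /=.
  by apply: eq_recursive (rec_const k 0) => v _; rewrite nth_nil.
apply: (@eq_recursive _ (fun v =>
    if n v == 0 then f v else nth 0 [seq f v | f <- fs] (n v).-1)).
  by move=> v _; case: (n v).
apply: rec_if0 => //; first by apply: Hfs; left.
by apply: IH; [exact: rec_pred | move=> g Hg; apply: Hfs; right].
Qed.

(** * Pairing *)

(* [cpair a b = 2 ^ a * (2 * b + 1)] never vanishes, so [0] encodes the empty
   list. The definitions are locked because unification would unfold them. *)
Fact cpair_key : unit. Proof. by []. Qed.
Definition cpair := locked_with cpair_key (fun a b => iter a double b.*2.+1).
Definition cfst := locked_with cpair_key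
  (fun n => iter n (fun r => if odd (iter r half n) then r else r.+1) 0).
Definition csnd := locked_with cpair_key (fun n => (iter (cfst n) half n)./2).

Lemma cpair_def a b : cpair a b = iter a double b.*2.+1.
Proof. by rewrite /cpair unlock. Qed.

Lemma cfst_def n :
  cfst n = iter n (fun r => if odd (iter r half n) then r else r.+1) 0.
Proof. by rewrite /cfst unlock. Qed.

Lemma csnd_def n : csnd n = (iter (cfst n) half n)./2.
Proof. by rewrite /csnd unlock. Qed.

Lemma iter_half_cpair i a b : i <= a -> iter i half (cpair a b) = cpair (a - i) b.
Proof.
elim: i => [|i IH] lt; first by rewrite subn0.
rewrite iterS IH 1?ltnW // !cpair_def subnS.
by rewrite -(prednK (n := a - i)) ?subn_gt0 //= doubleK.
Qed.

Lemma cpairE a b : cpair a b = 2 ^ a * b.*2.+1.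
Proof.
rewrite cpair_def; elim: a => [|a IH]; first by rewrite mul1n.
by rewrite iterS IH expnS -mul2n mulnA.
Qed.

Lemma cpair_gt0 a b : 0 < cpair a b.
Proof. by rewrite cpairE muln_gt0 expn_gt0. Qed.

(** [cfst] is the 2-adic valuation: its counter rises until that many halvings leave an odd number.
    After [i] rounds it is [minn i a], and [cpair a b >= 2^a > a] rounds are made. *)
Lemma cpairK1 a b : cfst (cpair a b) = a.
Proof.
set f := fun r => if odd (iter r half (cpair a b)) then r else r.+1.
have Hmin i : iter i f 0 = minn i a.
  elim: i => [|i IH]; first by rewrite min0n.
  rewrite iterS IH /f iter_half_cpair ?geq_minr //.
  have [le_ai|lt_ia] := leqP a i.
    by rewrite subnn cpair_def /= odd_double (minn_idPr (leqW le_ai)).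
  rewrite (minn_idPl lt_ia) -(prednK (n := a - i)) ?subn_gt0 //.
  by rewrite cpair_def /= odd_double.
rewrite cfst_def Hmin; apply/minn_idPr; rewrite cpairE.
by rewrite (leq_trans (ltnW (ltn_expl a (ltnSn 1)))) // leq_pmulr.
Qed.

Lemma cpairK2 a b : csnd (cpair a b) = b.
Proof.
by rewrite csnd_def cpairK1 iter_half_cpair // subnn cpair_def /= uphalf_double.
Qed.

Lemma rec_cpair k f g : recursive k f -> recursive k g ->
  recursive k (fun v => cpair (f v) (g v)).
Proof.
apply: (rec_comp2 _ cpair).
apply: (@eq_recursive _ (fun v => iter (nth 0 v 0) double (nth 0 v 1).*2.+1)).
  by move=> v _; rewrite cpair_def.
apply: (rec_iter _ _ (fun=> double)).
- exact: rec_nth.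
- exact/rec_double/rec_head.
- exact/rec_succ/rec_double/rec_nth.
Qed.

Lemma rec_iter_half k n f : recursive k n -> recursive k f ->
  recursive k (fun v => iter (n v) half (f v)).
Proof.
by move=> Hn Hf; apply: (rec_iter _ _ (fun=> half)) => //; apply/rec_half/rec_head.
Qed.

Lemma rec_cfst k f : recursive k f -> recursive k (fun v => cfst (f v)).
Proof.
apply: (rec_comp1 _ cfst).
apply: (@eq_recursive _ (fun v => iter (nth 0 v 0)
  (fun r => if odd (iter r half (nth 0 v 0)) then r else r.+1) 0)).
  by move=> v _; rewrite cfst_def.
apply: (rec_iter _ _ (fun v r =>
  if odd (iter r half (nth 0 v 0)) then r else r.+1)); first exact: rec_nth.
  apply: (@eq_recursive _ (fun w =>
    if nat_of_bool (odd (iter (head 0 w) half (nth 0 (behead w) 0))) == 0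
    then (head 0 w).+1 else head 0 w)).
    by move=> w _; case: odd.
  apply: rec_if0; [|exact/rec_succ/rec_head|exact: rec_head].
  by apply/rec_odd/rec_iter_half; [exact: rec_head|exact: rec_nth_behead].
exact: rec_const.
Qed.

Lemma rec_csnd k f : recursive k f -> recursive k (fun v => csnd (f v)).
Proof.
move=> Hf; apply: (@eq_recursive _ (fun v => (iter (cfst (f v)) half (f v))./2)).
  by move=> v _; rewrite csnd_def.
by apply/rec_half/rec_iter_half => //; apply: rec_cfst.
Qed.

(** * A universal machine *)

(* A state [cpair C r] consists of a coded list [C] of instructions still to be
   run and a coded stack [r]; an instruction is [cpair tag argument]. *)
Definition step s :=
  let C := cfst s in let r := csnd s in
  let c := cfst C in let C' := csnd C in
  let t := cfst c in let q := csnd c in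
  let x := cfst r in let S := csnd r in
  nth 0 [:: cpair C' r;
    cpair C' (cpair 0 S);
    cpair C' (cpair x.+1 S);
    cpair C' (cpair x.-1 S);
    cpair C' (cpair (cfst x) S);
    cpair C' (cpair (csnd x) S);
    cpair C' (cpair x r);
    cpair C' (cpair (cfst S) (cpair x (csnd S)));
    cpair C' (cpair (cpair (cfst S) x) (csnd S));
    cpair (cpair (cfst q) (cpair (csnd q) C')) r;
    if cfst x == 0 then cpair C' (cpair (csnd x) S)
    else cpair (cpair q (cpair c C')) r] t.

Lemma rec_step k f : recursive k f -> recursive k (fun v => step (f v)).
Proof.
apply: (rec_comp1 _ step); pose s (v : seq nat) := nth 0 v 0.
pose C v := cfst (s v); pose r v := csnd (s v).
pose c v := cfst (C v); pose C' v := csnd (C v).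
pose t v := cfst (c v); pose q v := csnd (c v).
pose x v := cfst (r v); pose S v := csnd (r v).
have Hs : recursive 1 s by exact: rec_nth.
have HC : recursive 1 C by exact: rec_cfst.
have Hr : recursive 1 r by exact: rec_csnd.
have Hc : recursive 1 c by exact: rec_cfst.
have HC' : recursive 1 C' by exact: rec_csnd.
have Ht : recursive 1 t by exact: rec_cfst.
have Hq : recursive 1 q by exact: rec_csnd.
have Hx : recursive 1 x by exact: rec_cfst.
have HS : recursive 1 S by exact: rec_csnd.
apply: (rec_switch 1 t [:: fun v => cpair (C' v) (r v);
  fun v => cpair (C' v) (cpair 0 (S v));
  fun v => cpair (C' v) (cpair (x v).+1 (S v));
  fun v => cpair (C' v) (cpair (x v).-1 (S v));
  fun v => cpair (C' v) (cpair (cfst (x v)) (S v));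
  fun v => cpair (C' v) (cpair (csnd (x v)) (S v));
  fun v => cpair (C' v) (cpair (x v) (r v));
  fun v => cpair (C' v) (cpair (cfst (S v)) (cpair (x v) (csnd (S v))));
  fun v => cpair (C' v) (cpair (cpair (cfst (S v)) (x v)) (csnd (S v)));
  fun v => cpair (cpair (cfst (q v)) (cpair (csnd (q v)) (C' v))) (r v);
  fun v => if cfst (x v) == 0 then cpair (C' v) (cpair (csnd (x v)) (S v))
    else cpair (cpair (q v) (cpair (c v) (C' v))) (r v)] Ht) => g /= Hg.
repeat (case: Hg => [<-|Hg]; first
  by repeat first [exact: rec_const | assumption | apply: rec_cpair
    | apply: rec_cfst | apply: rec_csnd    
    | apply: rec_succ | apply: rec_pred | apply: rec_if0]).
by case: Hg.
Qed.

(** * Execution of stack code *)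

(** Since [C] is arbitrary, the code that follows an instruction can be taken as part of [C], so
    executions chain. *)
Definition exec c r r' :=
  forall C, exists k, iter k step (cpair (cpair c C) r) = cpair C r'.

Lemma exec_step t q r r' :
  (forall C, step (cpair (cpair (cpair t q) C) r) = cpair C r') ->
  exec (cpair t q) r r'.
Proof. by move=> H C; exists 1; apply: H. Qed.

Lemma iter_trans s k k' t u :
  iter k step s = t -> iter k' step t = u -> iter (k' + k) step s = u.
Proof. by move=> <-; rewrite iterD. Qed.

Definition c_zero := cpair 1 0.
Definition c_succ := cpair 2 0.
Definition c_pred := cpair 3 0.
Definition c_head := cpair 4 0.
Definition c_tail := cpair 5 0.
Definition c_dup := cpair 6 0.
Definition c_swap := cpair 7 0.
Definition c_push := cpair 8 0.
Definition c_seq a b := cpair 9 (cpair a b).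
(** The loop tests the head of the top stack entry and drops that head on exit. *)
Definition c_while a := cpair 10 a.
Definition c_id := cpair 0 0.
Definition c_cons a b :=
  c_seq c_dup (c_seq a (c_seq c_swap (c_seq b c_push))).

Lemma exec_seq a b r r' r'' : exec a r r' -> exec b r' r'' -> exec (c_seq a b) r r''.
Proof.
move=> Ha Hb C; have [k Hk] := Ha (cpair b C); have [k' Hk'] := Hb C.
exists (k' + k).+1; rewrite iterSr /step !(cpairK1, cpairK2) /=.
exact: iter_trans Hk Hk'.
Qed.

Definition computes c x y := forall S, exec c (cpair x S) (cpair y S).

Lemma computes_prim t f : (forall C x S,
    step (cpair (cpair (cpair t 0) C) (cpair x S)) = cpair C (cpair (f x) S)) ->
  forall x, computes (cpair t 0) x (f x).
Proof. by move=> H x S C; exists 1; apply: H. Qed.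

Lemma computes_id x : computes c_id x x.
Proof.
by apply: (computes_prim 0 id) => *; rewrite /step !(cpairK1, cpairK2).
Qed.

Lemma computes_zero x : computes c_zero x 0.
Proof.
by apply: (computes_prim 1 (fun=> 0)) => *; rewrite /step !(cpairK1, cpairK2).
Qed.

Lemma computes_succ x : computes c_succ x x.+1.
Proof.
by apply: (computes_prim 2 succn) => *; rewrite /step !(cpairK1, cpairK2).
Qed.

Lemma computes_pred x : computes c_pred x x.-1.
Proof.
by apply: (computes_prim 3 predn) => *; rewrite /step !(cpairK1, cpairK2).
Qed.

Lemma computes_head x : computes c_head x (cfst x).
Proof.
by apply: (computes_prim 4 cfst) => *; rewrite /step !(cpairK1, cpairK2).
Qed.

Lemma computes_tail x : computes c_tail x (csnd x).
Proof.
by apply: (computes_prim 5 csnd) => *; rewrite /step !(cpairK1, cpairK2).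
Qed.

Lemma computes_seq a b x y z :
  computes a x y -> computes b y z -> computes (c_seq a b) x z.
Proof. by move=> Ha Hb S; apply: exec_seq (Ha S) (Hb S). Qed.

Lemma computes_cons a b x y z :
  computes a x y -> computes b x z -> computes (c_cons a b) x (cpair y z).
Proof.
move=> Ha Hb S; apply: (exec_seq _ _ _ (cpair x (cpair x S))).
  by apply: exec_step => C; rewrite /step !(cpairK1, cpairK2).
apply: exec_seq (Ha _) _; apply: (exec_seq _ _ _ (cpair x (cpair y S))).
  by apply: exec_step => C; rewrite /step !(cpairK1, cpairK2).
apply: exec_seq (Hb _) _.
by apply: exec_step => C; rewrite /step !(cpairK1, cpairK2).
Qed.

Lemma computes_while_done a x : computes (c_while a) (cpair 0 x) x.
Proof. by move=> S; apply: exec_step => C; rewrite /step !(cpairK1, cpairK2). Qed.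

Lemma computes_while a i x y z : computes a (cpair i.+1 x) y ->
  computes (c_while a) y z -> computes (c_while a) (cpair i.+1 x) z.
Proof.
move=> Ha Hw S C; have [k Hk] := Ha S (cpair (c_while a) C).
have [k' Hk'] := Hw S C; exists (k' + k).+1.
by rewrite iterSr /step !(cpairK1, cpairK2) /=; apply: iter_trans Hk Hk'.
Qed.

(** * Compilation of programs to stack code *)

Definition clist := foldr cpair 0.

(** On the empty list this rests on [cfst 0 = 0], in agreement with the convention that a missing
    argument is 0. *)
Lemma cfst_clist v : cfst (clist v) = head 0 v.
Proof. by case: v => [|a v] /=; rewrite ?cpairK1 ?cfst_def. Qed.

Lemma csnd_clist v : csnd (clist v) = clist (behead v).
Proof. by case: v => [|a v] /=; rewrite ?cpairK2 ?csnd_def ?cfst_def. Qed.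

(* The loop runs on [k :: i :: z :: v], where [z] is the value at [i] and [k]
   iterations remain. *)
Definition c_prec_loop g := c_while (c_cons (c_seq c_head c_pred) (c_seq c_tail
  (c_cons (c_seq c_head c_succ) (c_cons g (c_seq c_tail c_tail))))).
Definition c_prec f g := c_seq
  (c_cons c_head (c_cons c_zero (c_cons (c_seq c_tail f) c_tail)))
  (c_seq (c_prec_loop g) (c_seq c_tail c_head)).

(* The loop runs on [f (n :: v) :: n :: v]. *)
Definition c_mu_loop f := c_while (c_seq
  (c_seq c_tail (c_cons (c_seq c_head c_succ) c_tail)) (c_cons f c_id)).
Definition c_mu f := c_seq (c_seq (c_cons c_zero c_id) (c_cons f c_id))
  (c_seq (c_mu_loop f) c_head).

Fixpoint compile p := match p with
  | PZero => c_zero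
  | PSucc => c_seq c_head c_succ
  | PProj i => c_seq (iter i (c_seq c_tail) c_id) c_head
  | PComp f gs => c_seq (foldr (fun g => c_cons (compile g)) c_zero gs) (compile f)
  | PPrec f g => c_prec (compile f) (compile g)
  | PMu f => c_mu (compile f)
  end.

Lemma computes_nth i v :
  computes (c_seq (iter i (c_seq c_tail) c_id) c_head) (clist v) (nth 0 v i).
Proof.
apply: (computes_seq _ _ _ (clist (drop i v))); last first.
  rewrite -{2}[i]addn0 -nth_drop nth0 -cfst_clist.
  exact: computes_head.
elim: i v => [|i IH] v; first by rewrite drop0; apply: computes_id.
have -> : drop i.+1 v = drop i (behead v) by case: v.
apply: (computes_seq _ _ _ (clist (behead v))); rewrite // -csnd_clist.
exact: computes_tail.
Qed.

Lemma computes_head_cons x v : computes c_head (clist (x :: v)) x.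
Proof. by have := computes_head (clist (x :: v)); rewrite cfst_clist. Qed.

Lemma computes_tail_cons x v : computes c_tail (clist (x :: v)) (clist v).
Proof. by have := computes_tail (clist (x :: v)); rewrite csnd_clist. Qed.

Lemma computes_prec_loop g k n z v z' y :
  computes g (clist [:: n, z & v]) z' ->
  computes (c_prec_loop g) (clist [:: k, n.+1, z' & v]) y ->
  computes (c_prec_loop g) (clist [:: k.+1, n, z & v]) y.
Proof.
move=> Hg Hk; apply: computes_while Hk; apply: computes_cons.
  apply: computes_seq; first exact: (computes_head_cons _ [:: n, z & v]).
  exact: computes_pred.
apply: computes_seq; first exact: (computes_tail_cons _ [:: n, z & v]).
apply: computes_cons.
  apply: computes_seq; first exact: (computes_head_cons _ (z :: v)).
  exact: computes_succ.
apply: computes_cons => //.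
apply: computes_seq; first exact: (computes_tail_cons _ (z :: v)).
exact: computes_tail_cons.
Qed.

Lemma computes_prec f g n v z0 z : computes f (clist v) z0 ->
  computes (c_prec_loop g) (clist [:: n, 0, z0 & v]) (clist [:: n, z & v]) ->
  computes (c_prec f g) (clist (n :: v)) z.
Proof.
move=> Hf Hl; apply: computes_seq.
  apply: computes_cons; first exact: computes_head_cons.
  apply: computes_cons; first exact: computes_zero.
  apply: computes_cons; last exact: computes_tail_cons.
  by apply: computes_seq Hf; apply: computes_tail_cons.
apply: computes_seq Hl _.
by apply: computes_seq; [exact: computes_tail_cons | exact: computes_head_cons].
Qed.

Lemma computes_mu f n v : computes f (clist (n :: v)) 0 ->
  (forall m, m < n -> exists k, computes f (clist (m :: v)) k.+1) ->
  computes (c_mu f) (clist v) n.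
Proof.
move=> H0 Hlt.
have Hinit m k : computes f (clist (m :: v)) k ->
    computes (c_cons f c_id) (clist (m :: v)) (clist [:: k, m & v]).
  by move=> Hk; apply: computes_cons Hk _; apply: computes_id.
(* Induction on the distance [i] to the minimiser: the loop is followed backwards from its exit at
   [n]. *)
have Hloop i : i <= n -> exists2 k, computes f (clist (n - i :: v)) k &
    computes (c_mu_loop f) (clist [:: k, n - i & v]) (clist (n :: v)).
  elim: i => [_|i IH lt_in].
    rewrite subn0; exists 0 => //; exact: (computes_while_done _ (clist (n :: v))).
  have [|k Hk] := Hlt (n - i.+1); first by rewrite ltn_subrL (leq_trans _ lt_in).
  exists k.+1 => //; have [k' Hk' Hl] := IH (ltnW lt_in).
  apply: computes_while Hl; apply: computes_seq (Hinit _ _ Hk').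
  apply: computes_seq; first exact: (computes_tail_cons _ (_ :: v)).
  rewrite -[n - i]prednK ?subn_gt0 // -subnS; apply: computes_cons.
    by apply: computes_seq; [exact: computes_head_cons | exact: computes_succ].
  exact: computes_tail_cons.
have [k] := Hloop n (leqnn n); rewrite subnn => Hk Hl.
apply: (computes_seq _ _ _ (clist [:: k, 0 & v])).
  apply: computes_seq (Hinit _ _ Hk); apply: computes_cons; last exact: computes_id.
  exact: computes_zero.
by apply: computes_seq Hl _; apply: computes_head_cons.
Qed.

(** An evaluation of [PPrec] unfolds downwards from [n], whereas the compiled loop counts upwards
    from 0. The second half of [P] bridges this: whatever the loop yields from stage [n] with [k]
    rounds left, it yields from stage 0 with [k + n] rounds left. *)
Lemma compile_correct p v y : eval p v y -> computes (compile p) (clist v) y.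
Proof.
pose P p v y := computes (compile p) (clist v) y /\
  forall f g n v', p = PPrec f g -> v = n :: v' ->
  exists2 z0, computes (compile f) (clist v') z0 & forall k x,
    computes (c_prec_loop (compile g)) (clist [:: k, n, y & v']) x ->
    computes (c_prec_loop (compile g)) (clist [:: k + n, 0, z0 & v']) x.
pose Q gs v ws := computes (foldr (fun g => c_cons (compile g)) c_zero gs)
  (clist v) (clist ws).
suff HP p' v' y' : eval p' v' y' -> P p' v' y' by move=> /HP[].
have prec_of_loop f g n w z0 z : computes (compile f) (clist w) z0 ->
    (forall k x,
      computes (c_prec_loop (compile g)) (clist [:: k, n, z & w]) x ->
      computes (c_prec_loop (compile g)) (clist [:: k + n, 0, z0 & w]) x) ->
    computes (compile (PPrec f g)) (clist (n :: w)) z.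
  move=> Hf Hl; apply: computes_prec Hf _.
  by apply: (Hl 0); apply: (computes_while_done _ (clist [:: n, z & w])).
move: p' v' y'; apply: (eval_nested_ind _ Q).
- by move=> w; split=> //; apply: computes_zero.
- move=> w; split=> //; rewrite -cfst_clist.
  by apply: computes_seq; [exact: computes_head | exact: computes_succ].
- by move=> i w; split=> //; apply: computes_nth.
- by move=> f gs w ws z Hgs [Hf _]; split=> //; apply: computes_seq Hgs Hf.
- move=> f g w z [Hf _]; split.
    by apply: (prec_of_loop _ _ _ _ z) => // k x; rewrite addn0.
  by move=> _ _ _ _ [<- <-] [<- <-]; exists z => // k x; rewrite addn0.
- move=> f g n w z x [_ /(_ _ _ _ _ erefl erefl) [z0 Hf Hl]] [Hg _].
  have Hl' k u : computes (c_prec_loop (compile g)) (clist [:: k, n.+1, x & w]) u ->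
      computes (c_prec_loop (compile g)) (clist [:: k + n.+1, 0, z0 & w]) u.
    by move=> Hu; rewrite addnS -addSn; apply: Hl; apply: computes_prec_loop Hg Hu.
  split; first exact: prec_of_loop Hf Hl'.
  by move=> _ _ _ _ [<- <-] [<- <-]; exists z0.
- move=> f w n [H0 _] Hlt; split=> //; apply: computes_mu => // m /Hlt[k _ [Hk _]].
  by exists k.
- by move=> w; apply: computes_zero.
- by move=> g gs w x ws [Hg _] Hgs; apply: computes_cons.
Qed.

(** The empty code list [0] decodes to an instruction of tag 0 followed by [0] again, so a halted
    machine keeps its stack forever. *)
Lemma step_halted s j : cfst s = 0 ->
  cfst (iter j step s) = 0 /\ csnd (iter j step s) = csnd s.
Proof.
move=> s0; elim: j => [|j [IH1 IH2]] //=.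
have c0 : cfst 0 = 0 by rewrite cfst_def.
have d0 : csnd 0 = 0 by rewrite csnd_def c0.
by rewrite {1 3}/step IH1 c0 c0 d0 /= cpairK1 cpairK2.
Qed.

(* Universality for total functions is all that the diagonalization needs. *)
Lemma universal_program : exists W, forall f, recursive 1 f ->
  exists e, forall n, eval W [:: e; n] (f [:: n]).
Proof.
(* [state [:: k; e; n]] is reached after [k] steps of the code [e] on the argument list [[:: n]].
   The universal program searches for the first [k] at which no code remains. *)
pose state w := iter (nth 0 w 0) step
  (cpair (cpair (nth 0 w 1) 0) (cpair (cpair (nth 0 w 2) 0) 0)).
have Hstate : recursive 3 state.
  apply: (rec_iter _ _ (fun=> step)); first exact: rec_nth.
    exact/rec_step/rec_head.
  by repeat first [exact: rec_nth | exact: rec_const | apply: rec_cpair].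
have [T HT] : recursive 3 (fun w => cfst (state w)) by exact: rec_cfst.
have [out Hout] : recursive 3 (fun w => cfst (csnd (state w))).
  exact/rec_cfst/rec_csnd.
exists (PComp out [:: PMu T; PProj 0; PProj 1]) => f [p Hp].
exists (compile p) => n.
have [k Hk] := compile_correct _ _ _ (Hp [:: n] erefl) 0 0.
have ex_halt : exists k, cfst (state [:: k; compile p; n]) == 0.
  by exists k; rewrite /state /= Hk cpairK1.
case: (ex_minnP ex_halt) => k0 /eqP k0_halt k0_min.
apply: (evComp (ws := [:: k0; compile p; n])).
  constructor; last by constructor; [exact: (evProj 0) | constructor;
    [exact: (evProj 1) | constructor]].
  constructor; first by rewrite -k0_halt; apply: (HT [:: k0; compile p; n]).
  move=> m lt_m; exists (cfst (state [:: m; compile p; n])).-1.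
  rewrite prednK; first exact: (HT [:: m; compile p; n]).
  by rewrite lt0n; apply: contraL lt_m => /k0_min; rewrite -leqNgt.
have <- : cfst (csnd (state [:: k0; compile p; n])) = f [:: n].
  (* The run is known to be finished at [k]; the stack has not changed since the first halting time
     [k0]. *)
  have le_k : k0 <= k by apply: k0_min; rewrite /state /= Hk cpairK1.
  have [_ <-] := step_halted _ (k - k0) k0_halt.
  by rewrite /state /= -iterD subnK // Hk !(cpairK1, cpairK2).
exact: (Hout [:: k0; compile p; n]).
Qed.

(** Determinism makes [x] the only possible argument of [f], so the equivalence also transfers
    undefinedness. *)
Lemma eval_comp1 f q v x y : eval q v x ->
  eval (PComp f [:: q]) v y <-> eval f [:: x] y.
Proof.
move=> Hq; split=> [H|]; last first.
  by move=> Hf; apply: (evComp (ws := [:: x])); [repeat constructor|].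
inversion H as [| | | ? ? ? ws ? Hqs Hf | | |]; subst.
inversion Hqs as [| ? ? ? x' ? Hq' Hnil]; subst.
by inversion Hnil; subst; rewrite (eval_functional _ _ _ _ Hq Hq').
Qed.

(** * Coding of strings *)

Lemma foldl_bits_gt0 (s : bstr) : 0 < foldl (fun a (b : bool) => a.*2 + b) 1 s.
Proof.
elim/last_ind: s => // s b IH; rewrite foldl_rcons.
by rewrite (leq_trans IH) // -addnn -addnA leq_addr.
Qed.

Lemma code_ofS (s : bstr) :
  (code_of s).+1 = foldl (fun a (b : bool) => a.*2 + b) 1 s.
Proof. by rewrite prednK // foldl_bits_gt0. Qed.

Lemma code_of_rcons s b : (code_of (rcons s b)).+1 = (code_of s).+1.*2 + b.
Proof. by rewrite !code_ofS foldl_rcons. Qed.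

Lemma code_of_inj : injective code_of.
Proof.
elim/last_ind=> [|s b IH] s' /(congr1 succn); case/lastP: s' => [|s' b'] //.
- by rewrite code_of_rcons doubleS => -[]; rewrite addnC addnS.
- by rewrite code_of_rcons doubleS => -[]; rewrite addnC addnS.
rewrite !code_of_rcons => E; have eb : b = b'.
  by have := congr1 odd E; rewrite !oddD !odd_double; case: b b' {E} => [] [].
move: E; rewrite eb => /addIn/double_inj[] /IH -> //.
Qed.

(** The equation is boolean so that [xchoose] can select a preimage. *)
Lemma code_of_surj n : exists s, code_of s == n.
Proof.
elim/ltn_ind: n => -[|n] IH; first by exists [::].
(* In the code plus one, the last bit of the string is the parity and the other bits give the
   half. *)
have [|s /eqP Hs] := IH (n.+2./2).-1.
  by rewrite /= ltnS; rewrite -[leqRHS](doubleK) half_leq // -addnn leq_addr.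
exists (rcons s (odd n.+2)); rewrite -eqSS code_of_rcons Hs prednK //.
by rewrite addnC odd_double_half.
Qed.

Definition decode n := xchoose (code_of_surj n).

Lemma decodeK : cancel decode code_of.
Proof. by move=> n; apply/eqP/(xchooseP (code_of_surj n)). Qed.

Lemma size_code_of s : 2 ^ size s <= (code_of s).+1 < 2 ^ (size s).+1.
Proof.
elim/last_ind: s => // s b /andP[lo hi].
rewrite code_of_rcons size_rcons; apply/andP; split.
  by rewrite expnS mul2n (leq_trans _ (leq_addr _ _)) // leq_double.
rewrite expnS mul2n (@leq_trans (code_of s).+2.*2) ?leq_double //.
by rewrite (doubleS (code_of s).+1); case: b; rewrite ?addn0 ?addn1 ltnS.
Qed.

Lemma size_decode n k : (size (decode n) < k) = (n.+1 < 2 ^ k).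
Proof.
have /andP[] := size_code_of (decode n); rewrite decodeK => lo hi.
apply/idP/idP => [lt_k|lt_n].
  by apply: leq_trans hi _; rewrite leq_exp2l.
by rewrite -(ltn_exp2l _ _ (ltnSn 1)); apply: leq_ltn_trans lo lt_n.
Qed.

(** * Diagonalization *)

(** Totality turns the reduction into a function on codes, computed by the same program, so that it
    composes with other [recursive] functions. *)
Lemma optimal_reduction U V : effectively_optimal U ->
  exists g : nat -> nat, [/\ recursive 1 (fun v => g (nth 0 v 0)),
    exists c, forall n, size (decode (g n)) <= size (decode n) + c &
    forall n m, eval V [:: n] m <-> eval U [:: g n] m].
Proof.
move=> /(_ V)[h [htot [[c hc] hV]]].
have hrun n : exists m, eval h [:: n] m.
  by have [y] := htot (decode n); rewrite /runs decodeK; exists (code_of y).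
have [g Hg] := choice hrun.
have Hruns n : runs h (decode n) (decode (g n)) by rewrite /runs !decodeK.
exists g; split.
- by exists h => -[|n []].
- by exists c => n; apply: hc.
- move=> n m; have := hV _ _ (Hruns n) (decode m).
  by rewrite /runs !decodeK.
Qed.

Lemma code_bit0 : code_of bit0 = 1. Proof. by []. Qed.
Lemma code_bit1 : code_of bit1 = 2. Proof. by []. Qed.

(* The index of [N] is [cfst N.+1], and [N X] below is the [X]-th input of
   index [e]; [5] is the code of the third string. *)
Lemma many_errors U h : effectively_optimal U -> bit_valued h ->
  exists d (z : nat -> bstr), [/\ injective z,
    forall n X, X < 2 ^ n -> size (z X) <= n + d &
    forall X, err h (fun x => runs U x bit0) (fun x => runs U x bit1) (z X)].
Proof.
move=> optU hbit; have [W HW] := universal_program.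
have [idx Hidx] : recursive 1 (fun v => cfst (nth 0 v 0).+1).
  exact/rec_cfst/rec_succ/rec_nth.
pose V := PComp U [:: PComp W [:: idx; PProj 0]].
have [g [g_rec [c g_size] g_red]] := optimal_reduction U V optU.
(* The bits have codes 1 and 2, so [3 - b] negates a bit. *)
have [neg Hneg] : recursive 1 (fun v => 3 - nth 0 v 0).
  by apply: rec_subn; [exact: rec_const | exact: rec_nth].
have [k [k_rec _ k_red]] := optimal_reduction U (PComp neg [:: h]) optU.
have [five Hfive] : recursive 1 (fun=> 5) by exact: rec_const.
have [k5 [_ _ k5_red]] := optimal_reduction U five optU.
have U5 : eval U [:: k5 0] 5 by apply/k5_red; apply: (Hfive [:: 0]).
(* Collisions become zeros of a recursive function, which [rec_mu] can search. [least N] is the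
   first input with the index and the [g]-value of [N], hence [N - least N = 0] says that [N] has no
   earlier collision. *)
pose dist m n := (m - n) + (n - m).
have dist0 m n : (dist m n == 0) = (m == n).
  by rewrite /dist addn_eq0 !subn_eq0 -eqn_leq.
pose D i N := dist (cfst i.+1) (cfst N.+1) + dist (g i) (g N).
have D0 i N : (D i N == 0) = (cfst i.+1 == cfst N.+1) && (g i == g N).
  by rewrite addn_eq0 !dist0.
have exD N : exists i, D i N == 0 by exists N; rewrite D0 !eqxx.
pose least N := ex_minn (exD N).
have least_rec : recursive 1 (fun v => least (nth 0 v 0)).
  apply: (rec_mu _ _ (fun i v => D i (nth 0 v 0))).
  - repeat first [exact: rec_head | exact: rec_nth_behead | apply: rec_addn
      | apply: rec_subn | apply: rec_cfst | apply: rec_succ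
      | apply: (rec_comp1 _ g)] => //.
  - by move=> v _; rewrite /least; case: ex_minnP => i /eqP.
  - move=> v i _; rewrite /least; case: ex_minnP => m _ m_min lt_im.
    by apply: contraL lt_im => /m_min; rewrite -leqNgt.
(* The program compares the index of an input with that of [N], so it never mentions its own index
   [e]. *)
have [e He] : exists e, forall N,
    eval W [:: e; N] (if N - least N == 0 then k (g N) else k5 0).
  apply: (HW (fun v => if nth 0 v 0 - least (nth 0 v 0) == 0
    then k (g (nth 0 v 0)) else k5 0)).
  apply: rec_if0; last exact: rec_const.
    by apply: rec_subn => //; apply: rec_nth.
  exact: (rec_comp1 _ k).
have V_eval N y : cfst N.+1 = e ->
    eval V [:: N] y <-> eval U [:: if N - least N == 0 then k (g N) else k5 0] y.
  move=> eN; apply: eval_comp1; apply: (evComp (ws := [:: e; N])) (He N).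
  constructor; first by rewrite -eN; apply: (Hidx [:: N]).
  by constructor; [exact: (evProj 0) | constructor].
have neg_h n y : eval (PComp neg [:: h]) [:: n] y ->
    exists2 b, eval h [:: n] b & y = 3 - b.
  move=> H; inversion H as [| | | ? ? ? ws ? Hhs Hn | | |]; subst.
  inversion Hhs as [| ? ? ? b ? Hh Hnil]; subst; exists b => //.
  inversion Hnil; subst.
  exact: eval_functional Hn (Hneg [:: b] erefl).
have h_code n b : eval h [:: n] b -> b = 1 \/ b = 2.
  move=> Hb; have := hbit (decode n) (decode b).
  rewrite /runs !decodeK => /(_ Hb)[] /(congr1 code_of); rewrite decodeK => ->.
    by left.
  by right.
have g_inj N1 N2 : cfst N1.+1 = e -> cfst N2.+1 = e -> N1 < N2 -> g N1 <> g N2.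
  move=> e1 e2 lt12 eg.
  have least2 : least N2 < N2.
    rewrite /least; case: ex_minnP => m _ m_min; apply: leq_ltn_trans lt12.
    by apply: m_min; rewrite D0 e1 e2 eg !eqxx.
  have V2 : eval U [:: g N2] 5.
    by apply/g_red/V_eval => //; rewrite subn_eq0 leqNgt least2.
  (* [m] is the first member of the collision class, so [V] computes [3 - h (g m)] there. As [U]
     takes the value 5 at [g m = g N2], [h] is defined at [g m] with a value [b] such that
     [5 = 3 - b], which is absurd. *)
  set m := least N2 in least2.
  have [em gm] : cfst m.+1 = e /\ g m = g N2.
    rewrite /m /least; case: ex_minnP => i; rewrite D0 e2.
    by case/andP=> /eqP ? /eqP.
  have leastm : m <= least m.
    rewrite {1}/m {2}/least /least; case: ex_minnP => i _ i_min.
    case: ex_minnP => j; rewrite D0 gm em => Dj _; apply: i_min.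
    by rewrite D0 e2.
  have : eval V [:: m] 5 by apply/g_red; rewrite gm.
  move/V_eval => /(_ em); rewrite (eqP (_ : m - least m == 0)) // => /k_red.
  by case/neg_h => b /h_code[] ->.
pose N X := (cpair e X).-1.
have NS X : (N X).+1 = cpair e X by rewrite prednK ?cpair_gt0.
have eN X : cfst (N X).+1 = e by rewrite NS cpairK1.
have gN_inj : injective (fun X => g (N X)).
  move=> X Y eg; suff eNXY : N X = N Y.
    by rewrite -(cpairK2 e X) -(cpairK2 e Y) -!NS eNXY.
  by case: (ltngtP (N X) (N Y)) => // /g_inj; [case/(_ (eN X) (eN Y)) |
    case/(_ (eN Y) (eN X))].
(* The index costs [e] bits and the reduction [c]: if [X < 2^n], then
   [N X + 1 = 2^e (2X + 1) < 2^(n + e + 1)], so the input has length at most [n + e]. *)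
exists (e + c), (fun X => decode (g (N X))); split.
- by move=> X Y /(can_inj decodeK)/gN_inj.
- move=> n X lt_X; apply: leq_trans (g_size _) _.
  rewrite addnA leq_add2r -ltnS size_decode NS cpairE addnC -addnS expnD.
  rewrite ltn_pmul2l ?expn_gt0 // expnS mul2n -doubleS leq_double; exact: lt_X.
- move=> X; set z := g (N X).
  (* An earlier collision would contradict the injectivity of [g] on index [e], so the program
     always takes its first branch. *)
  have least_N : N X <= least (N X).
    rewrite leqNgt; apply/negP => lt_N.
    move: (erefl (least (N X))); rewrite {1}/least; case: ex_minnP => m.
    rewrite D0 (eN X) => /andP[/eqP em /eqP gm] _ E.
    by rewrite E in em gm; apply: g_inj em (eN X) lt_N gm.
  have UzE y : eval U [:: z] y <-> eval (PComp neg [:: h]) [:: z] y.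
    split; first move/g_red/(V_eval _ _ (eN X)).
      by rewrite (eqP (_ : N X - least (N X) == 0)) // => /k_red.
    move=> /k_red H; apply/g_red/(V_eval _ _ (eN X)).
    by rewrite (eqP (_ : N X - least (N X) == 0)).
  have Uz b : eval h [:: z] b -> eval U [:: z] (3 - b).
    move=> Hb; apply/UzE/(eval_comp1 _ _ _ _ _ Hb).
    exact: (Hneg [:: b]).
  case: (pselect (defined h (decode z))) => [[y Hy]|]; last by left.
  right; rewrite /runs !decodeK code_bit0 code_bit1.
  have := hbit _ _ Hy; move: Hy; rewrite /runs decodeK => Hy [] Ey; move: Hy.
    by rewrite Ey => Hy; right; split=> //; apply: (Uz 1).
  by rewrite Ey => Hy; left; split=> //; apply: (Uz 2).
Qed.

(** * Counting and densities *)

Lemma size_strs_of_len k : size (strs_of_len k) = 2 ^ k.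
Proof.
elim: k => //= k IH.
by rewrite size_cat cats0 !size_map IH expnS mul2n addnn.
Qed.

Lemma mem_strs_of_len (s : bstr) : s \in strs_of_len (size s).
Proof.
elim: s => //= b s IH; rewrite !mem_cat.
by case: b; rewrite (map_f _ IH) ?orbT.
Qed.

Lemma mem_strs_upto n (s : bstr) : size s <= n -> s \in strs_upto n.
Proof.
move=> le_sn; apply/flatten_mapP; exists (size s); last exact: mem_strs_of_len.
by rewrite mem_iota.
Qed.

Lemma size_strs_upto n : size (strs_upto n) < 2 ^ n.+1.
Proof.
rewrite /strs_upto size_flatten /shape -map_comp.
rewrite (eq_map (g := expn 2)); last exact: size_strs_of_len.
elim: n => // n IH; rewrite -(addn1 n.+1) iotaD map_cat sumn_cat /= addn0.
by rewrite addn1 [ltnRHS]expnS mul2n -addnn ltn_add2r.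
Qed.

Lemma mem_pdec_filter (T : eqType) (P : T -> Prop) (s : seq T) x :
  P x -> x \in s -> x \in [seq x <- s | pdec (P x)].
Proof.
by rewrite mem_filter /pdec; case: ClassicalDescription.excluded_middle_informative.
Qed.

(** The first [m] values of [z] form a duplicate-free list contained in the filtered one. *)
Lemma pcount_strs_upto_ge (P : bstr -> Prop) (z : nat -> bstr) m n :
  injective z -> (forall X, X < m -> P (z X) /\ size (z X) <= n) ->
  m <= pcount P (strs_upto n).
Proof.
move=> z_inj Hz; rewrite -[m](size_iota 0) -(size_map z); apply: uniq_leq_size.
  by rewrite map_inj_uniq // iota_uniq.
move=> _ /mapP[X + ->]; rewrite mem_iota => /Hz[PX sX].
by apply: mem_pdec_filter => //; apply: mem_strs_upto.
Qed.

Lemma pcount_strs_upto_le (P : bstr -> Prop) n : pcount P (strs_upto n) <= 2 ^ n.+1.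
Proof.
by rewrite /pcount size_filter (leq_trans (count_size _ _)) // ltnW // size_strs_upto.
Qed.

Local Open Scope classical_set_scope.
Local Open Scope ring_scope.

(** [limn_inf] is the limit of the tail infima in [R], a meaningful value only if they converge. The
    bounds 0 and [M] ensure this and identify the limit as the supremum of these infima. *)
Lemma limn_inf_ge (R : realType) (u : nat -> R) c M d :
  (forall n, 0 <= u n <= M) -> (forall n, (d <= n)%N -> c <= u n) ->
  c <= limn_inf u.
Proof.
move=> u_bnd u_ge.
have u_lb : has_lbound (range u).
  by exists 0 => _ [n _ <-]; case/andP: (u_bnd n).
have u_ub : has_ubound (range u).
  by exists M => _ [n _ <-]; case/andP: (u_bnd n).
have infs_ub : has_ubound (range (infs u)).
  exists M => _ [n _ <-]; apply: (@le_trans _ _ (u n)); last by case/andP: (u_bnd n).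
  apply: ge_inf; last by exists n => /=.
  by exists 0 => _ [m _ <-]; case/andP: (u_bnd m).
rewrite /limn_inf (cvg_lim _ (cvg_infs_sup u_ub u_lb)) //.
apply: (@le_trans _ _ (infs u d)); last by apply: ub_le_sup => //; exists d.
apply: lb_le_inf; first by exists (u d), d => /=.
by move=> _ [m /= le_dm <-]; apply: u_ge.
Qed.

Theorem theorem7p1 (R : realType) (U : prf) :
  effectively_optimal U ->
  let A := fun x => runs U x bit0 in
  let B := fun x => runs U x bit1 in
  [/\ disjoint_sets A B, computably_inseparable A B &
      forall h : prf, bit_valued h ->
        0 < limn_inf (fun n => err_density R h A B n)].
Proof.
move=> optU A B; split.
- by move=> x [Ax Bx]; have := eval_functional _ _ _ _ Ax Bx.
- move=> [h [h_tot [h_bit [hA hB]]]].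
  (* The single error [z 0] already refutes a total separator. *)
  have [d [z [_ _ /(_ 0%N)]]] := many_errors U h optU h_bit.
  case=> [|[[/hA h0 h1]|[/hB h1 h0]]]; first by apply; apply: h_tot.
    by have := eval_functional _ _ _ _ h0 h1.
  by have := eval_functional _ _ _ _ h0 h1.
move=> h h_bit; have [d [z [z_inj z_size z_err]]] := many_errors U h optU h_bit.
have pow_gt0 n : 0 < (2 ^ n)%:R :> R by rewrite ltr0n expn_gt0.
(* For [n >= d] the strings [z X] with [X < 2^(n - d)] are distinct errors of length at most [n], of
   density [2^(n - d) / 2^(n + 1) = 2^-(d + 1)]. *)
apply: (@lt_le_trans _ _ (2 ^ d.+1)%:R^-1); first by rewrite invr_gt0.
apply: (limn_inf_ge _ _ _ 1 d) => n; rewrite /err_density.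
  rewrite divr_ge0 //= ler_pdivrMr // mul1r ler_nat.
  exact: pcount_strs_upto_le.
move=> le_dn; rewrite ler_pdivlMr // mulrC ler_pdivrMr // -natrM ler_nat.
rewrite -(subnK le_dn) -addnS expnD leq_mul2r; apply/orP; right.
by apply: (pcount_strs_upto_ge _ z) => // X lt_X; split; [exact: z_err | exact: z_size].
Qed.
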